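(* Let $\kappa$ be a cardinal with $1<\kappa\leq|\mathrm{Var}\,\mathrm L|^+$. Let $\mathrm L$ be a coatomic logic with the $\kappa$-ary local IL w.r.t. a family $\Psi$ such that each $I\in\Psi_1$ has cardinality less than $\kappa$. Then for each set of formulas $\Gamma$ and each formula $\varphi$: $\Gamma\vdash_{\alpha_{\mathrm{Th}}(\mathrm L)}\varphi$ if and only if for each $I\in\Psi_1$ there is some $J\in\Psi_{|I|}$ such that $\Gamma\vdash_{\mathrm L}J(I(\varphi))$.
   Context: A logic $\mathrm{L}$ is given by an infinite set of variables $\mathrm{Var}\,\mathrm L$, the absolutely free algebra of formulas $\mathbf{Fm}\,\mathrm L$ over it in some signature (with underlying set $\mathrm{Fm}\,\mathrm{L}$), and a relation $\Gamma \vdash_{\mathrm{L}} \varphi$ between sets of formulas and formulas which is reflexive, monotone, closed under cut (if $\Gamma \vdash_{\mathrm L} \varphi$ for all $\varphi\in\Phi$ and $\Phi \vdash_{\mathrm L} \psi$, then $\Gamma \vdash_{\mathrm L} \psi$) and structural (closed under substitutions). $\Gamma\vdash_{\mathrm L}\Phi$ means $\Gamma\vdash_{\mathrm L}\varphi$ for all $\varphi\in\Phi$. A theory is a set of formulas closed under $\vdash_{\mathrm L}$; it is simple if it is maximal among theories different from $\mathrm{Fm}\,\mathrm L$. $\mathrm L$ is coatomic if every theory different from $\mathrm{Fm}\,\mathrm L$ is included in a simple theory. The semisimple companion $\alpha_{\mathrm{Th}}(\mathrm L)$ is the logic determined by the matrices $\langle\mathbf{Fm}\,\mathrm L,T\rangle$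 with $T$ a simple theory of $\mathrm L$: $\Gamma\vdash_{\alpha_{\mathrm{Th}}(\mathrm L)}\varphi$ iff for every simple theory $T$ of $\mathrm L$ and every substitution $\sigma$, $\sigma[\Gamma]\subseteq T$ implies $\sigma(\varphi)\in T$. $\mathrm L$ enjoys the $\kappa$-ary local IL w.r.t. $\Psi$ if for each ordinal $0<\alpha<\kappa$, $\Psi_\alpha$ is a family of sets of formulas $I(\overline p)$ in an $\alpha$-tuple of distinct variables $\overline p$ such that for each set of formulas $\Gamma$ and each $\alpha$-tuple of formulas $\overline\varphi$: $\Gamma,\overline\varphi\vdash_{\mathrm L}\mathrm{Fm}\,\mathrm L$ iff $\Gamma\vdash_{\mathrm L}I(\overline\varphi)$ for some $I\in\Psi_\alpha$, where $I(\overline\varphi)$ is the result of substituting $\overline\varphi$ for $\overline p$. $J(I(\varphi))$ abbreviates $J(\overline\chi)$, where $\overline\chi$ is a tuple of length $|I|$ (the cardinal $|I|$ viewed as an ordinal) consisting precisely of the elements of $I(\varphi)$, some of them possibly repeated. The sets $I\in\Psi_1$ are understood to be non-empty, so that $\Psi_{|I|}$ is defined. *)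

(* Defs.v *)
(* MathComp, with the classical sets and cardinals of MathComp-Analysis. *)
From HB Require Import structures.
From mathcomp Require Import all_boot all_order.
From mathcomp Require Import boolp classical_sets functions cardinality wochoice.

Set Implicit Arguments.
Unset Strict Implicit.
Unset Printing Implicit Defensive.

Import Order.TTheory.
Local Open Scope classical_set_scope.
Local Open Scope card_scope.

(** * Formulas and logics *)

Record signature := Signature { symbol : Type; arity : symbol -> nat }.

Section Formulas.
Variables (S : signature) (V : Type).

(* The absolutely free S-algebra over V. *)
Inductive formula :=
| Atom (x : V)
| App (f : symbol S) (args : 'I_(arity f) -> formula).

(* A substitution is an endomorphism of the free algebra; it is represented by
   its restriction s to the variables, of which [subst s] is the extension. *)
Fixpoint subst (s : V -> formula) (phi : formula) : formula :=
  match phi with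
  | Atom x => s x
  | App f args => App (fun i => subst s (args i))
  end.

Fixpoint vars (phi : formula) : set V :=
  match phi with
  | Atom x => [set x]
  | App f args => [set x | exists i, vars (args i) x]
  end.

Lemma subst_comp (s t : V -> formula) phi :
  subst t (subst s phi) = subst (fun x => subst t (s x)) phi.
Proof.
by elim: phi => [//|f args IH] /=; congr App; apply/funext => i; exact: IH.
Qed.

End Formulas.

Record logic := Logic {
  sig : signature;
  Var : Type;
  Var_infinite : infinite_set [set: Var];
  entails : set (formula sig Var) -> formula sig Var -> Prop;
  entails_refl : forall Gamma phi, Gamma phi -> entails Gamma phi;
  entails_mono : forall Gamma Delta phi,
    Gamma `<=` Delta -> entails Gamma phi -> entails Delta phi;
  entails_cut : forall Gamma Phi psi,
    (forall phi, Phi phi -> entails Gamma phi) -> entails Phi psi ->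
    entails Gamma psi;
  entails_struct : forall Gamma phi (s : Var -> formula sig Var),
    entails Gamma phi -> entails (subst s @` Gamma) (subst s phi)
}.

Arguments entails : clear implicits.

Definition Fm (L : logic) := formula (sig L) (Var L).

Section Theories.
Variable L : logic.

Definition entails_set (Gamma Phi : set (Fm L)) :=
  forall phi, Phi phi -> entails L Gamma phi.

Definition is_theory (T : set (Fm L)) := forall phi, entails L T phi -> T phi.

Definition is_simple (T : set (Fm L)) :=
  [/\ is_theory T, T <> setT &
      forall T', is_theory T' -> T' <> setT -> T `<=` T' -> T' = T].

Definition coatomic :=
  forall T : set (Fm L), is_theory T -> T <> setT ->
  exists2 T', is_simple T' & T `<=` T'.

Definition companion_entails (Gamma : set (Fm L)) (phi : Fm L) :=
  forall (T : set (Fm L)) (s : Var L -> Fm L), is_simple T ->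
  subst s @` Gamma `<=` T -> T (subst s phi).

Lemma companion_refl Gamma phi : Gamma phi -> companion_entails Gamma phi.
Proof. by move=> Gphi T s _; apply; exists phi. Qed.

Lemma companion_mono Gamma Delta phi :
  Gamma `<=` Delta -> companion_entails Gamma phi -> companion_entails Delta phi.
Proof.
by move=> GD Gphi T s simT sD; apply: Gphi => // _ [psi /GD Dpsi <-];
  apply: sD; exists psi.
Qed.

Lemma companion_cut Gamma Phi psi :
  (forall phi, Phi phi -> companion_entails Gamma phi) ->
  companion_entails Phi psi -> companion_entails Gamma psi.
Proof.
move=> GPhi Phipsi T s simT sG; apply: Phipsi => // _ [phi Phiphi <-].
exact: GPhi Phiphi T s simT sG.
Qed.

Lemma companion_struct Gamma phi (s : Var L -> Fm L) :
  companion_entails Gamma phi ->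
  companion_entails (subst s @` Gamma) (subst s phi).
Proof.
move=> Gphi T t simT tsG; rewrite subst_comp; apply: Gphi => // _ [psi Gpsi <-].
by rewrite -subst_comp; apply: tsG; exists (subst s psi) => //; exists psi.
Qed.

Definition semisimple_companion : logic :=
  {| Var_infinite := @Var_infinite L;
     entails_refl := companion_refl;
     entails_mono := companion_mono;
     entails_cut := companion_cut;
     entails_struct := companion_struct |}.

End Theories.

(** * Cardinals and ordinals

   A non-zero cardinal kappa is represented by a well-ordered type K of order
   type kappa that is an initial ordinal.  As for von Neumann ordinals, the
   ordinals below kappa are then exactly the elements of K, an ordinal a being
   identified with the set of smaller ones, [below a]. *)

Definition card_lt T U (A : set T) (B : set U) := A #<= B /\ ~ (B #<= A).

Definition is_succ_card (V N : Type) :=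
  card_lt [set: V] [set: N] /\
  forall M : Type, card_lt [set: V] [set: M] -> [set: N] #<= [set: M].

Definition le_succ_card (K V : Type) :=
  exists2 N : Type, is_succ_card V N & [set: K] #<= [set: N].

Section Ordinals.
Context {d : Order.disp_t} {K : bOrderType d}.

Definition below (a : K) : set K := [set b | (b < a)%O].

Definition is_initial (a : K) :=
  forall b, (b < a)%O -> card_lt (below b) (below a).

Definition one_ord : K := xget \bot%O [set a | below a = [set \bot%O]].

(* The cardinal |A| as an ordinal below kappa; meaningful when |A| < kappa
   (see [ocardP]; [enumerationP]
   then enumerates A, or an image of it, by a tuple of length |A|). *)
Definition ocard T (A : set T) : K :=
  xget \bot%O [set a | is_initial a /\ below a #= A].

Definition otuple (X : Type) (a : K) := {b : K | (b < a)%O} -> X.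

End Ordinals.

Definition is_cardinal d (K : bOrderType d) :=
  well_order (<=%O : rel K) /\
  forall a : K, card_lt (below a) [set: K].

(** * The local inconsistency lemma *)

Section LocalIL.
Context {d : Order.disp_t} {K : bOrderType d} {L : logic}.

Definition tuple_subst (a : K) (p : otuple (Var L) a) (chi : otuple (Fm L) a)
    (x : Var L) : Fm L :=
  if pselect (exists i, p i = x) is left px then chi (projT1 (cid px))
  else Atom (sig L) x.

(* I(chi), for a set I of formulas in the distinct variables p. *)
Definition instance (a : K) (p : otuple (Var L) a) (I : set (Fm L))
    (chi : otuple (Fm L) a) : set (Fm L) :=
  subst (tuple_subst p chi) @` I.

(* p a is the tuple of variables in which the members of Psi a are written;
   the values of p and Psi at the ordinal 0 are irrelevant. *)
Definition local_IL (p : forall a : K, otuple (Var L) a)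
    (Psi : K -> set (set (Fm L))) :=
  forall a : K, (\bot < a)%O ->
  [/\ injective (p a),
      forall I phi, Psi a I -> I phi -> vars phi `<=` range (p a) &
      forall (Gamma : set (Fm L)) (phi : otuple (Fm L) a),
        entails_set (Gamma `|` range phi) setT <->
        exists2 I, Psi a I & entails_set Gamma (instance (p a) I phi)].

End LocalIL.

(** * Existence of the ordinals and enumerations used in the statement *)

Section Existence.
Context {d : Order.disp_t} {K : bOrderType d} (HK : is_cardinal K).

Lemma least_ord (P : set K) : P !=set0 ->
  exists2 a, P a & forall b, P b -> (a <= b)%O.
Proof.
move=> [x Px]; have [|a [[aP amin] _]] := HK.1 (mem P).
  by exists x; rewrite inE.
exists a; first by move: aP; rewrite inE.
by move=> b Pb; apply: amin; rewrite inE.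
Qed.

Lemma ord_wf : well_founded (fun b a : K => (b < a)%O).
Proof.
move=> x; apply: contrapT => nx.
have [a na amin] := @least_ord [set a | ~ Acc (fun b a : K => (b < a)%O) a]
  (ex_intro _ x nx).
apply: na; constructor => b ba; apply: contrapT => /amin.
by rewrite leNgt ba.
Qed.

Lemma one_ordP : card_lt [set: unit] [set: K] -> below (one_ord : K) = [set \bot%O].
Proof.
move=> K_gt1; apply: (@xgetPex K \bot%O [set a | below a = [set \bot%O]]).
have [|a a_gt0 amin] := @least_ord [set a | (\bot < a)%O].
  apply: contrapT => K1; apply: K_gt1.2.
  have <- : (fun=> \bot%O : K) @` [set: unit] = [set: K].
    apply/seteqP; split=> // a _; exists tt => //.
    apply: contrapT => /eqP a0; apply: K1.
    by exists a; rewrite /= lt0x eq_sym.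
  exact: card_image_le.
exists a; apply/seteqP; split=> b /=; last by move=> ->.
rewrite /below /= => ba; apply: contrapT => /eqP b0.
by have := amin b; rewrite /= lt0x leNgt ba => /(_ b0).
Qed.

Lemma ocardP T (A : set T) : card_lt A [set: K] ->
  is_initial (ocard A : K) /\ below (ocard A : K) #= A.
Proof.
move=> [_ ltAK].
apply: (@xgetPex K \bot%O [set a | is_initial a /\ below a #= A]).
suff [a0 a0A] : exists a : K, below a #= A.
  have [|a aA amin] := @least_ord [set a | below a #= A]; first by exists a0.
  exists a; split=> // b ba; split.
    by apply: subset_card_le => c cb; apply: lt_trans ba.
  move=> ab; have := amin b; rewrite /= leNgt ba => F.
  have /F : below b #= A; last by [].
  apply: card_eq_trans aA; apply: Cantor_Bernstein => //.
  by apply: subset_card_le => c cb; apply: lt_trans ba.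
pose step b (h : forall c : K, (c < b)%O -> option T) : option T :=
  if pselect (exists x, A x /\ forall c (cb : (c < b)%O), h c cb <> Some x)
    is left e then Some (projT1 (cid e)) else None.
pose h := Fix ord_wf (fun=> option T) step.
have hE b : h b = step b (fun c _ => h c).
  rewrite /h Fix_eq // => x f g fg; congr step.
  by apply: functional_extensionality_dep => c; apply/funext.
have hA b x : h b = Some x -> A x.
  by rewrite hE /step; case: pselect => // e [<-]; case: (cid e) => y [].
have hlt b c : (c < b)%O -> h b <> None -> h c <> h b.
  move=> cb; rewrite [h b]hE /step; case: pselect => // e _.
  by case: (cid e) => y /= [_ hy]; exact: hy.
have h_inj b c : h b <> None -> h b = h c -> b = c.
  move=> hb bc; case: (ltgtP b c) => // lt_bc.
    by case: (hlt _ _ lt_bc); rewrite -?bc.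
  by case: (hlt _ _ lt_bc); rewrite ?bc// -bc.
have [a ha amin] : exists2 a, h a = None & forall b, h b = None -> (a <= b)%O.
  apply: (@least_ord [set a | h a = None]); apply: contrapT => hN.
  have hS b : h b <> None by move=> hb; apply: hN; exists b.
  apply: ltAK.
  have /card_esym/card_eqPle[+ _] : h @` [set: K] #= [set: K].
    by apply: inj_card_eq => b c _ _; apply: h_inj.
  move=> /card_le_trans; apply; rewrite -card_le_some; apply: subset_card_le.
  move=> _ [b _ <-]; have := hS b; case E : (h b) => [x|] // _.
  by exists x => //; apply: hA E.
have hS b : (b < a)%O -> h b <> None.
  by move=> ba /amin; rewrite leNgt ba.
exists a; apply: (card_eq_trans (B := h @` below a)).
  apply: card_esym; apply: inj_card_eq => b c; rewrite inE => ba _.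
  exact/h_inj/hS.
suff -> : h @` below a = some @` A by apply: card_some.
apply/seteqP; split=> [_ [b ba <-]|_ [x Ax <-]].
  have := hS _ ba; case E : (h b) => [x|] // _.
  by exists x => //; apply: hA E.
apply: contrapT => hx; move: ha; rewrite hE /step; case: pselect => // -[].
by exists x; split=> // b ba hb; apply: hx; exists b.
Qed.

Lemma enumerationP T (A : set T) X (f : T -> X) : card_lt A [set: K] ->
  exists chi : otuple X (ocard A : K), range chi = f @` A.
Proof.
move=> /ocardP[_ /card_bijP[g [g' gK g'K]]].
exists (fun i => f (val (g (SigSub (mem_set (svalP i)))))).
apply/seteqP; split=> [_ [i _ <-]|_ [x Ax <-]].
  by exists (val (g (SigSub (mem_set (svalP i))))) => //; apply/set_mem/valP.
have := g'K (SigSub (mem_set Ax)).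
case: (g' _) => b bP gb; exists (exist _ b (set_mem bP)) => //=.
rewrite (_ : SigSub _ = SigSub bP) ?gb //; exact: val_inj.
Qed.

End Existence.

(* Main.v *)
(* By the local IL the right-hand condition says that [Gamma, I(phi)] is
   inconsistent for every [I] in [Psi_1].  A simple theory omits [phi] iff it
   contains [I(phi)] for some [I] in [Psi_1], so no simple theory extending
   [Gamma] omits [phi] iff, by coatomicity, all the sets [Gamma, I(phi)] are
   inconsistent.  Since an arbitrary substitution need not preserve
   inconsistency, the form [Gamma |- J(I(phi))] is what is transported along
   substitutions. *)
Require Import Defs.
From mathcomp Require Import all_boot all_order.
From mathcomp Require Import boolp classical_sets functions cardinality.

Set Implicit Arguments.
Unset Strict Implicit.
Unset Printing Implicit Defensive.

Import Order.TTheory.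
Local Open Scope classical_set_scope.

Lemma eq_subst_in S V (s t : V -> formula S V) psi :
  (forall x, vars psi x -> s x = t x) -> subst s psi = subst t psi.
Proof.
elim: psi => [x|f args IH] /= st; first exact: st.
by congr App; apply/funext => i; apply: IH => x xi; apply: st; exists i.
Qed.

Lemma subst_Atom S V (psi : formula S V) : subst (@Atom S V) psi = psi.
Proof. by elim: psi => //= f args IH; congr App; apply/funext. Qed.

Section Logic.
Context {L : logic}.
Implicit Types (Gamma T : set (Fm L)) (phi psi : Fm L).

Lemma deductive_closure_theory Gamma : is_theory [set psi | entails L Gamma psi].
Proof. by move=> psi; apply: entails_cut. Qed.

Lemma simple_consistent T : is_simple T -> ~ entails_set T setT.
Proof.
move=> [thT TN _] Tinc; apply: TN; apply/seteqP; split=> // psi _.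
exact/thT/Tinc.
Qed.

(** Otherwise the deductive closure of [T] and [phi] would be a theory different from [setT]
    extending [T], hence equal to [T] by maximality, although it contains [phi]. *)
Lemma simple_maximal T phi :
  is_simple T -> ~ T phi -> entails_set (T `|` [set phi]) setT.
Proof.
move=> [_ _ maxT] nTphi psi _; apply: contrapT => npsi; apply: nTphi.
rewrite -(maxT _ (@deductive_closure_theory (T `|` [set phi]))).
- by apply: entails_refl; right.
- by move=> E; apply: npsi; have : [set: Fm L] psi by []; rewrite -E.
- by move=> x Tx; apply: entails_refl; left.
Qed.

Lemma coatomic_simple Gamma : coatomic L -> ~ entails_set Gamma setT ->
  exists2 T, is_simple T & Gamma `<=` T.
Proof.
move=> coL Gcons.
have [|T simT GT] := coL _ (@deductive_closure_theory Gamma).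
  by move=> E; apply: Gcons => psi _; have : [set: Fm L] psi by []; rewrite -E.
by exists T => // psi Gpsi; apply/GT/entails_refl.
Qed.

(** [tuple_subst] fixes the variables outside [p], while [s] may move them; the hypothesis keeps
    such variables out of [I]. *)
Lemma subst_instance {d : Order.disp_t} {K : bOrderType d} (a : K)
    (p : otuple (Var L) a) (I : set (Fm L)) (chi : otuple (Fm L) a)
    (s : Var L -> Fm L) :
  (forall psi, I psi -> vars psi `<=` range p) ->
  subst s @` instance p I chi = instance p I (fun i => subst s (chi i)).
Proof.
move=> Ip; rewrite /instance image_comp; apply: eq_imagel => psi Ipsi /=.
rewrite subst_comp; apply: eq_subst_in => x /(Ip _ Ipsi)[i _ pix].
by rewrite /tuple_subst; case: pselect => // -[]; exists i.
Qed.

End Logic.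

Section Ordinals.
Context {d : Order.disp_t} {K : bOrderType d}.

Lemma one_ord_gt0 :
  is_cardinal K -> card_lt [set: unit] [set: K] -> (\bot < one_ord :> K)%O.
Proof.
move=> K_card /(one_ordP K_card) E.
by have : [set \bot%O : K] \bot%O by []; rewrite -E.
Qed.

(** [local_IL] speaks only of ordinals above [\bot]; this makes it applicable at the length of a
    non-empty [I]. *)
Lemma ocard_gt0 T (A : set T) :
  is_cardinal K -> card_lt A [set: K] -> A !=set0 -> (\bot < ocard A :> K)%O.
Proof.
move=> K_card /(ocardP K_card)[_ cA] A0; rewrite lt0x.
apply/eqP => o0; move: cA; rewrite o0 (_ : below \bot%O = set0).
  by rewrite card_eq_sym card_eq0 => /eqP A_eq0; case: A0; rewrite A_eq0.
by apply/seteqP; split=> // b; rewrite /below /= ltx0.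
Qed.

End Ordinals.

Theorem proposition4p27
    (d : Order.disp_t) (K : bOrderType d) (L : logic)
    (p : forall a : K, otuple (Var L) a) (Psi : K -> set (set (Fm L)))
    (K_card : is_cardinal K)
    (K_gt1 : card_lt [set: unit] [set: K])
    (K_le : le_succ_card K (Var L))
    (L_coatomic : coatomic L)
    (L_IL : local_IL p Psi)
    (Psi1_neq0 : forall I, Psi one_ord I -> I !=set0)
    (Psi1_lt : forall I, Psi one_ord I -> card_lt I [set: K])
    (Gamma : set (Fm L)) (phi : Fm L)
    (chi : forall I : set (Fm L), otuple (Fm L) (ocard I : K))
    (chi_enum : forall I, Psi one_ord I ->
       range (chi I) = instance (p one_ord) I (fun=> phi)) :
  entails (semisimple_companion L) Gamma phi <->
  forall I, Psi one_ord I ->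
    exists2 J, Psi (ocard I) J &
      entails_set Gamma (instance (p (ocard I)) J (chi I)).
Proof.
have one_gt0 := one_ord_gt0 K_card K_gt1.
have [_ p1 IL1] := L_IL _ one_gt0.
have range_cst psi :
    range ((fun=> psi) : otuple (Fm L) (one_ord : K)) = [set psi].
  have i0 : {b : K | (b < one_ord)%O} by exists \bot%O.
  by apply/seteqP; split=> [_ [i _ <-]//|_ ->]; exists i0.
have ILI I (I1 : Psi one_ord I) := L_IL _
  (ocard_gt0 K_card (Psi1_lt _ I1) (Psi1_neq0 _ I1)).
split=> [Gphi I I1|H T s simT sGT].
- have [_ _ ILJ] := ILI I I1; apply/ILJ; rewrite chi_enum//.
  apply: contrapT => /(coatomic_simple L_coatomic)[T simT GIT].
  apply: (simple_consistent simT).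
  (* The companion entailment is used at the identity substitution [Atom]. *)
  have Tphi : T phi.
    rewrite -[phi]subst_Atom; apply: Gphi => // _ [psi Gpsi <-].
    by rewrite subst_Atom; apply: GIT; left.
  (* Since [T] contains both [phi] and [I(phi)], the local IL read from right to left makes it
     inconsistent. *)
  have -> : T = T `|` range ((fun=> phi) : otuple (Fm L) (one_ord : K)).
    by rewrite range_cst; apply/esym/setUidPl => _ ->.
  by apply/IL1; exists I => // psi Ipsi; apply/entails_refl/GIT; right.
- apply: contrapT => nTphi; apply: (simple_consistent simT).
  have := simple_maximal simT nTphi.
  rewrite -range_cst => /IL1[I I1 TI].
  have [J J1 GJ] := H _ I1; have [_ pJ ILJ] := ILI I I1.
  (* Structurality carries [J(I(phi))] along [s], and [ILJ] at the substituted tuple turns the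
     result back into an inconsistency. *)
  have : entails_set (subst s @` Gamma `|` range (fun i => subst s (chi I i)))
      setT.
    apply/ILJ; exists J => //; rewrite -subst_instance; last first.
      by move=> psi; apply: pJ.
    by move=> _ [psi Jpsi <-]; apply/entails_struct/GJ.
  (* By cut, [T] is inconsistent: it contains the image of [Gamma], and it entails each
     [subst s (chi I i)], a member of [I] at [subst s phi]. *)
  move=> inc psi /inc; apply: entails_cut => psi' [/sGT|[i _ <-]].
    exact: entails_refl.
  apply: TI; rewrite -(@subst_instance _ _ _ _ _ _ (fun=> phi)); last first.
    by move=> x; apply: p1.
  by exists (chi I i) => //; rewrite -chi_enum//; exists i.
Qed.
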